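(* Let $\mathcal{I}$ be a category with pullbacks and let $p:\mathcal{M}\to\mathcal{I}$ be a fibered category (a Grothendieck fibration). Let $\mathcal{D}\subseteq\mathcal{M}$ be the subcategory with all the objects and whose arrows are the $p$-cartesian arrows, let $d:\mathcal{D}\to\mathcal{I}$ be the restriction of $p$, and let $\mathrm{sp}(\mathcal{M},\mathcal{D})$ consist of the commutative squares in $\mathcal{M}$ with $p$-cartesian horizontal sides whose image in $\mathcal{I}$ is a pullback square. Then $(d,p,\mathrm{sp}(\mathcal{M},\mathcal{D}))$ is a fibered multicategory.
   Context: **Fibered multicategory.** A fibered multicategory $(d,p,\mathrm{sp}(\mathcal{M},\mathcal{D}))$ consists of: a category $\mathcal{I}$ with pullbacks; a fibration in groupoids $d:\mathcal{D}\to\mathcal{I}$ (a fibration in which all arrows of $\mathcal{D}$ are cartesian); a category $\mathcal{M}$ with the same objects as $\mathcal{D}$ and a functor $p:\mathcal{M}\to\mathcal{I}$ coinciding with $d$ on objects; and a class $\mathrm{sp}(\mathcal{M},\mathcal{D})$ of ''special squares'', as follows. A square $(f',f;b,a)$ consists of horizontal arrows $f':U\to X$ (top), $f:V\to Y$ (bottom) in $\mathcal{D}$ and vertical arrows $b:U\to V$ (left), $a:X\to Y$ (right) in $\mathcal{M}$. The squares such that $pa\circ df'=df\circ pb$ is a pullback square in $\mathcal{I}$ form a double category $\mathrm{pb}(\mathcal{M},\mathcal{D})$ under horizontal and vertical pasting. The special squares form a sub double category of it: they are closed under horizontal and vertical pasting and contain the squares $(\mathrm{id},\mathrm{id};a,a)$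 for all $a$ in $\mathcal{M}$ and $(f,f;\mathrm{id},\mathrm{id})$ for all $f$ in $\mathcal{D}$. Moreover they satisfy the unique special lifting axiom: given $a:X\to Y$ in $\mathcal{M}$, arrows $f':U\to X$ and $f:V\to Y$ in $\mathcal{D}$, and $g:dU\to dV$ in $\mathcal{I}$ such that $pa\circ df'=df\circ g$ is a pullback square, there is a unique $b:U\to V$ in $\mathcal{M}$ with $pb=g$ and $(f',f;b,a)$ special. *)

(* Defs.v *)
From Stdlib Require Import ProofIrrelevance.

Set Implicit Arguments.
Unset Strict Implicit.
Unset Printing Implicit Defensive.

(* Categories are parametrised by their type of objects, so that "having the
   same objects" and "functors coinciding on objects" need no transport. *)
Record category (O : Type) : Type := Category {
  hom : O -> O -> Type;
  idm : forall x, hom x x;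
  comp : forall x y z, hom y z -> hom x y -> hom x z;
  comp_idl : forall x y (f : hom x y), comp (idm y) f = f;
  comp_idr : forall x y (f : hom x y), comp f (idm x) = f;
  comp_assoc : forall x y z t (h : hom z t) (g : hom y z) (f : hom x y),
    comp h (comp g f) = comp (comp h g) f
}.

Arguments hom {O} C x y : rename.
Arguments idm {O C} x : rename.
Arguments comp {O C x y z} g f : rename.
Arguments comp_idl {O C x y} f : rename.
Arguments comp_idr {O C x y} f : rename.
Arguments comp_assoc {O C x y z t} h g f : rename.

Declare Scope cat_scope.
Delimit Scope cat_scope with cat.
Notation "g ∘ f" := (comp g f) (at level 40, left associativity) : cat_scope.
Local Open Scope cat_scope.

(* [functor C C' F] is the type of functors with object map [F]. *)
Record functor (O O' : Type) (C : category O) (C' : category O')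
    (F : O -> O') : Type := Functor {
  fmap : forall x y, hom C x y -> hom C' (F x) (F y);
  fmap_id : forall x, fmap (idm x) = idm (F x);
  fmap_comp : forall x y z (g : hom C y z) (f : hom C x y),
    fmap (g ∘ f) = fmap g ∘ fmap f
}.

Arguments fmap {O O' C C' F} p {x y} f : rename.
Arguments fmap_id {O O' C C' F} p x : rename.
Arguments fmap_comp {O O' C C' F} p {x y z} g f : rename.

(*        h
      P -----> A
      |        |
    k |        | a      a ∘ h = b ∘ k
      v        v
      B -----> C
          b                      *)
Definition is_pullback (O : Type) (I : category O) (P A B C : O)
    (h : hom I P A) (k : hom I P B) (a : hom I A C) (b : hom I B C) : Prop :=
  a ∘ h = b ∘ k /\
  forall (Z : O) (u : hom I Z A) (v : hom I Z B), a ∘ u = b ∘ v ->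
    exists! w : hom I Z P, h ∘ w = u /\ k ∘ w = v.

Definition has_pullbacks (O : Type) (I : category O) : Prop :=
  forall (A B C : O) (a : hom I A C) (b : hom I B C),
    exists (P : O) (h : hom I P A) (k : hom I P B), is_pullback h k a b.

Section Fibrations.
Variables (O O' : Type) (M : category O) (I : category O') (p0 : O -> O').
Variable p : functor M I p0.

Definition cartesian (x y : O) (f : hom M x y) : Prop :=
  forall (z : O) (h : hom M z y) (g : hom I (p0 z) (p0 x)),
    fmap p h = fmap p f ∘ g ->
    exists! k : hom M z x, fmap p k = g /\ f ∘ k = h.

(* The equality of dependent pairs says that [p0 x = i] and that, along this
   equality, [fmap p f] is the given arrow [u]. *)
Definition fibration : Prop :=
  forall (y : O) (i : O') (u : hom I i (p0 y)),
    exists (x : O) (f : hom M x y), cartesian f /\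
      existT (fun j => hom I j (p0 y)) (p0 x) (fmap p f)
      = existT (fun j => hom I j (p0 y)) i u.

Definition fibration_in_groupoids : Prop :=
  fibration /\ forall (x y : O) (f : hom M x y), cartesian f.

Lemma cartesian_id (x : O) : cartesian (idm x).
Proof.
intros z h g Hg; exists h; split.
- split; [now rewrite Hg, fmap_id, comp_idl | apply comp_idl].
- intros k [_ Hk]; now rewrite <- Hk, comp_idl.
Qed.

Lemma cartesian_comp (x y z : O) (g : hom M y z) (f : hom M x y) :
  cartesian g -> cartesian f -> cartesian (g ∘ f).
Proof.
intros Cg Cf t h u Hu.
destruct (Cg t h (fmap p f ∘ u)) as [k [[pk gk] Uk]].
{ now rewrite Hu, fmap_comp, comp_assoc. }
destruct (Cf t k u pk) as [l [[pl fl] Ul]].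
exists l; split.
- split; [exact pl | now rewrite <- comp_assoc, fl].
- intros l' [pl' gl']; apply Ul; split; [exact pl' |].
  symmetry; apply Uk; split; [now rewrite fmap_comp, pl' |].
  now rewrite comp_assoc.
Qed.

End Fibrations.

Section WideSubcategory.
Variables (O : Type) (C : category O).
Variable P : forall x y : O, hom C x y -> Prop.
Hypothesis P_id : forall x, P (idm x).
Hypothesis P_comp : forall x y z (g : hom C y z) (f : hom C x y),
  P g -> P f -> P (g ∘ f).

Let shom (x y : O) : Type := {f : hom C x y | P f}.

Lemma wide_hom_eq (x y : O) (f g : shom x y) :
  proj1_sig f = proj1_sig g -> f = g.
Proof.
destruct f as [f Pf], g as [g Pg]; simpl; intros ->.
f_equal; apply proof_irrelevance.
Qed.

Definition wide_subcategory : category O.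
Proof.
refine (@Category O shom
  (fun x => exist _ (idm x) (P_id x))
  (fun x y z g f => exist _ (proj1_sig g ∘ proj1_sig f)
     (P_comp (proj2_sig g) (proj2_sig f))) _ _ _);
  intros; apply wide_hom_eq; simpl.
- apply comp_idl.
- apply comp_idr.
- apply comp_assoc.
Defined.

Definition wide_restriction (O' : Type) (C' : category O') (F : O -> O')
    (p : functor C C' F) : functor wide_subcategory C' F :=
  @Functor O O' wide_subcategory C' F
    (fun x y f => fmap p (proj1_sig f))
    (fun x => fmap_id p x)
    (fun x y z g f => fmap_comp p (proj1_sig g) (proj1_sig f)).

End WideSubcategory.

(* A square (f', f; b, a), with horizontal sides in [D] and vertical sides in
   [M], is a mere frame: it is only in the base that it can be said to commute.
            f'
        U -----> X
        |        |
      b |        | a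
        v        v
        V -----> Y
            f                                                              *)
Definition square_class (O : Type) (D M : category O) : Type :=
  forall U X V Y : O,
    hom D U X -> hom D V Y -> hom M U V -> hom M X Y -> Prop.

Section FiberedMulticategories.
Variables (OI O : Type) (I : category OI) (D M : category O) (o : O -> OI).
Variables (d : functor D I o) (p : functor M I o).

Definition pb_square : square_class D M := fun U X V Y f' f b a =>
  is_pullback (fmap d f') (fmap p b) (fmap p a) (fmap d f).

Record is_fibered_multicategory (sp : square_class D M) : Prop := {
  fm_pullbacks : has_pullbacks I;
  fm_groupoids : fibration_in_groupoids d;
  fm_pb : forall (U X V Y : O) (f' : hom D U X) (f : hom D V Y)
      (b : hom M U V) (a : hom M X Y),
    sp _ _ _ _ f' f b a -> pb_square f' f b a;
  fm_hpaste : forall (U X Z V Y W : O)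
      (f' : hom D U X) (g' : hom D X Z) (f : hom D V Y) (g : hom D Y W)
      (b : hom M U V) (a : hom M X Y) (c : hom M Z W),
    sp _ _ _ _ f' f b a -> sp _ _ _ _ g' g a c ->
    sp _ _ _ _ (g' ∘ f') (g ∘ f) b c;
  fm_vpaste : forall (U X V Y T Z : O)
      (f'' : hom D U X) (f' : hom D V Y) (f : hom D T Z)
      (b : hom M U V) (a : hom M X Y) (b' : hom M V T) (a' : hom M Y Z),
    sp _ _ _ _ f'' f' b a -> sp _ _ _ _ f' f b' a' ->
    sp _ _ _ _ f'' f (b' ∘ b) (a' ∘ a);
  fm_hid : forall (X Y : O) (a : hom M X Y),
    sp _ _ _ _ (idm X) (idm Y) a a;
  fm_vid : forall (X Y : O) (f : hom D X Y),
    sp _ _ _ _ f f (idm X) (idm Y);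
  fm_lift : forall (U X V Y : O) (a : hom M X Y)
      (f' : hom D U X) (f : hom D V Y) (g : hom I (o U) (o V)),
    is_pullback (fmap d f') g (fmap p a) (fmap d f) ->
    exists! b : hom M U V, fmap p b = g /\ sp _ _ _ _ f' f b a
}.

End FiberedMulticategories.

Section CartesianArrows.
Variables (OI O : Type) (I : category OI) (M : category O) (p0 : O -> OI).
Variable p : functor M I p0.

Definition cartesian_subcategory : category O :=
  wide_subcategory (@cartesian_id _ _ _ _ _ p) (@cartesian_comp _ _ _ _ _ p).

Definition cartesian_restriction : functor cartesian_subcategory I p0 :=
  wide_restriction (@cartesian_id _ _ _ _ _ p) (@cartesian_comp _ _ _ _ _ p) p.

Definition cartesian_squares : square_class cartesian_subcategory M :=
  fun U X V Y f' f b a =>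
    a ∘ proj1_sig f' = proj1_sig f ∘ b /\
    is_pullback (fmap p (proj1_sig f')) (fmap p b)
                (fmap p a) (fmap p (proj1_sig f)).

End CartesianArrows.

Arguments cartesian_squares {OI O I M p0} p U X V Y f' f b a.

(* Main.v *)
(* Cartesian arrows cancel on the left, so every lift of a cartesian arrow
   through a cartesian arrow is again cartesian; hence the cartesian arrows form
   a fibration in groupoids. The double category axioms are the pasting laws for
   pullbacks in the base, and the unique special lifting is the universal
   property of the bottom side, applied to the composite a ∘ f'. *)

Require Import Defs.

Local Open Scope cat_scope.

Section Pullbacks.
Variables (O : Type) (I : category O).

Lemma pullback_sym (P A B C : O)
    (h : hom I P A) (k : hom I P B) (a : hom I A C) (b : hom I B C) :
  is_pullback h k a b -> is_pullback k h b a.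
Proof.
intros [E U]; split; [now symmetry |].
intros Z u v Huv.
destruct (U Z v u (eq_sym Huv)) as [w [[hw kw] Uw]].
exists w; split; [now split |].
intros w' [kw' hw']; now apply Uw.
Qed.

Lemma pullback_paste (P A A' B C C' : O)
    (h : hom I P A) (k : hom I P B) (a : hom I A C) (b : hom I B C)
    (h' : hom I A A') (c : hom I A' C') (b' : hom I C C') :
  is_pullback h k a b -> is_pullback h' a c b' ->
  is_pullback (h' ∘ h) k c (b' ∘ b).
Proof.
intros [E U] [E' U']; split.
{ now rewrite comp_assoc, E', <- comp_assoc, E, comp_assoc. }
intros Z u v Huv.
(* The mediating arrow is built in two stages: the right square turns [u] and [b ∘ v] into [s] with
   target [A], then the left square turns [s] and [v] into [w]. *)
destruct (U' Z u (b ∘ v)) as [s [[h's as_] Us]].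
{ now rewrite Huv, comp_assoc. }
destruct (U Z s v as_) as [w [[hw kw] Uw]].
exists w; split.
- split; [now rewrite <- comp_assoc, hw | exact kw].
- intros w' [hw' kw']; apply Uw; split; [| exact kw'].
  symmetry; apply Us; split.
  + now rewrite comp_assoc.
  + now rewrite comp_assoc, E, <- comp_assoc, kw'.
Qed.

Lemma pullback_idl (X Y : O) (a : hom I X Y) :
  is_pullback (idm X) a a (idm Y).
Proof.
split; [now rewrite comp_idl, comp_idr |].
intros Z u v Huv; rewrite comp_idl in Huv.
exists u; split; [now rewrite comp_idl |].
intros w [Hw _]; now rewrite comp_idl in Hw.
Qed.

End Pullbacks.

Section Cartesian.
Variables (OI OM : Type) (I : category OI) (M : category OM) (p0 : OM -> OI).
Variable p : functor M I p0.

(** To factor [h] through [k], factor [f ∘ h] through [f ∘ k]; cartesianness of [f] then cancels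
    [f]. *)
Lemma cartesian_cancel (x y z : OM) (f : hom M y z) (k : hom M x y) :
  cartesian p f -> cartesian p (f ∘ k) -> cartesian p k.
Proof.
intros Cf Cfk t h u Hu.
destruct (Cfk t (f ∘ h) u) as [l [[pl fkl] Ul]].
{ now rewrite !fmap_comp, Hu, comp_assoc. }
destruct (Cf t (f ∘ h) (fmap p h) (fmap_comp p f h)) as [m [_ Um]].
exists l; split.
- split; [exact pl |].
  (* Both [k ∘ l] and [h] are the unique factorization [m] of [f ∘ h] through [f] over
     [fmap p h]. *)
  transitivity m; [symmetry |]; apply Um; split; try reflexivity.
  + now rewrite fmap_comp, pl.
  + now rewrite comp_assoc.
- intros l' [pl' kl']; apply Ul; split; [exact pl' |].
  now rewrite <- comp_assoc, kl'.
Qed.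

Lemma cartesian_restriction_cartesian (x y : OM)
    (f : hom (cartesian_subcategory p) x y) :
  cartesian (cartesian_restriction p) f.
Proof.
destruct f as [f Cf]; intros z [h Ch] g Hg; simpl in Hg.
destruct (Cf z h g Hg) as [k [[pk fk] Uk]].
(* The factorization found in [M] must itself be an arrow of the subcategory; it is, by cancelling
   [f] from the cartesian [h]. *)
assert (Ck : cartesian p k).
{ apply (cartesian_cancel _ _ _ f k Cf); now rewrite fk. }
exists (exist _ k Ck); split.
- split; [exact pk | now apply wide_hom_eq].
- intros [k' Ck'] [pk' fk']; apply wide_hom_eq; simpl in *.
  apply Uk; split; [exact pk' |].
  exact (f_equal (@proj1_sig _ _) fk').
Qed.

Lemma cartesian_restriction_groupoids :
  fibration p -> fibration_in_groupoids (cartesian_restriction p).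
Proof.
intros F; split; [| exact cartesian_restriction_cartesian].
intros y i u; destruct (F y i u) as [x [f [Cf Ef]]].
exists x, (exist _ f Cf); split; [| exact Ef].
apply cartesian_restriction_cartesian.
Qed.

End Cartesian.

Theorem proposition3p1 (OI OM : Type) (I : category OI) (M : category OM)
    (p0 : OM -> OI) (p : functor M I p0) :
  has_pullbacks I -> fibration p ->
  is_fibered_multicategory (cartesian_restriction p) p (cartesian_squares p).
Proof.
intros HI F; split.
- exact HI.
- now apply cartesian_restriction_groupoids.
- now intros U X V Y f' f b a [_ H].
- intros U X Z V Y W f' g' f g b a c [E1 P1] [E2 P2]; split; simpl.
  + now rewrite comp_assoc, E2, <- comp_assoc, E1, comp_assoc.
  + rewrite !fmap_comp; exact (pullback_paste _ _ _ _ _ _ _ _ _ _ _ _ _ _ _ P1 P2).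
- intros U X V Y T Z f'' f' f b a b' a' [E1 P1] [E2 P2]; split.
  + now rewrite <- comp_assoc, E1, comp_assoc, E2, comp_assoc.
  (* Reflecting the squares in the diagonal turns vertical pasting into horizontal pasting. *)
  + rewrite !fmap_comp; apply pullback_sym.
    eapply pullback_paste; apply pullback_sym; eassumption.
- intros X Y a; split; simpl.
  + now rewrite comp_idl, comp_idr.
  + rewrite !fmap_id; apply pullback_idl.
- intros X Y f; split; simpl.
  + now rewrite comp_idl, comp_idr.
  + rewrite !fmap_id; apply pullback_sym, pullback_idl.
- intros U X V Y a [f' Cf'] [f Cf] g P; simpl in P.
  (* A lift [b] of [g] makes the square commute exactly when it factors [a ∘ f'] through [f]. Once
     [fmap p b = g], the pullback condition on the square is [P] itself. *)
  destruct (Cf U (a ∘ f') g) as [b [[pb fb] Ub]].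
  { rewrite fmap_comp; exact (proj1 P). }
  exists b; split.
  + split; [exact pb |]; split; simpl; [now symmetry | now rewrite pb].
  + intros b' [pb' [Eb' _]]; apply Ub; split; [exact pb' | now symmetry].
Qed.
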